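(* Let $\mathcal{F}=\{f_{n}\}_{n\in\mathbb{N}}$ be a uniformly expanding time varying map on a complete metric space $(X,d)$ such that all the maps $f_n$ are surjective. Then: (a) $\mathcal{F}$ has the shadowing property; (b) $\mathcal{F}$ has the limit shadowing property; (c) $\mathcal{F}$ has the exponential limit shadowing property; (d) $\mathcal{F}$ has the s-limit shadowing property.
   Context: $\mathbb{N}=\{1,2,3,\dots\}$. A time varying map on a metric space $(X,d)$ is a sequence $\mathcal{F}=\{f_n\}_{n\in\mathbb{N}}$ of continuous maps $f_n:X\to X$. Put $\mathcal{F}_n:=f_n\circ f_{n-1}\circ\cdots\circ f_1$ for $n\ge 1$ and $\mathcal{F}_0:=\mathrm{Id}_X$. Uniformly expanding: the expanding ratio $\beta:=\inf_{n\in\mathbb{N}}\inf_{x,y\in X,\,x\ne y}\frac{d(f_n(x),f_n(y))}{d(x,y)}$ exists and is greater than one. For $\delta>0$, a sequence $\{x_n\}_{n\ge 0}$ in $X$ is a $\delta$-pseudo orbit of $\mathcal{F}$ if $d(f_{n+1}(x_n),x_{n+1})<\delta$ for all $n\ge 0$. It is a limit pseudo orbit if $d(f_{n+1}(x_n),x_{n+1})\to 0$ as $n\to+\infty$. For a real sequence $\{a_n\}_{n\ge0}$ and $\theta\in(0,1)$ write $a_n\xrightarrow{\theta}0$ if there is $L>0$ with $|a_n|\le L\theta^n$ for all $n\ge0$; $\{x_n\}_{n\ge0}$ is a $\theta$-exponentially limit pseudo orbit if $d(f_{n+1}(x_n),x_{n+1})\xrightarrow{\theta}0$. Shadowing property: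 for every $\varepsilon>0$ there is $\delta>0$ such that for every $\delta$-pseudo orbit $\{x_n\}_{n\ge0}$ in $X$ there is $x\in X$ with $d(\mathcal{F}_n(x),x_n)<\varepsilon$ for all $n\ge0$. Limit shadowing property: for every limit pseudo orbit $\{x_n\}_{n\ge0}$ in $X$ there is $x\in X$ with $d(\mathcal{F}_n(x),x_n)\to 0$ as $n\to+\infty$. Exponential limit shadowing property: there exists $\theta_0\in(0,1)$ such that for every $\theta\in(\theta_0,1)$ and every $\theta$-exponentially limit pseudo orbit $\{x_n\}_{n\ge0}$ in $X$ there is $x\in X$ with $d(\mathcal{F}_n(x),x_n)\xrightarrow{\theta}0$. s-limit shadowing property: for every $\varepsilon>0$ there is $\delta>0$ such that (1) for every $\delta$-pseudo orbit $\{x_n\}_{n\ge0}$ in $X$ there exists $x\in X$ with $d(\mathcal{F}_n(x),x_n)<\varepsilon$ for all $n\ge 0$, and (2) if in addition $\{x_n\}_{n\ge0}$ is a limit pseudo orbit, then (this $x$ can be taken so that) $d(\mathcal{F}_n(x),x_n)\to0$ as $n\to+\infty$. *)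

(* Defs.v *)
From HB Require Import structures.
From mathcomp Require Import all_boot all_order all_algebra.
From mathcomp Require Import all_classical all_reals all_analysis.

Set Implicit Arguments.
Unset Strict Implicit.
Unset Printing Implicit Defensive.

Import Order.TTheory GRing.Theory Num.Theory.
Import numFieldNormedType.Exports.

Local Open Scope classical_set_scope.
Local Open Scope ring_scope.

(* The library's [completeType] forces a distinguished point, which a metric
   space need not have, so completeness is stated as a predicate. *)
Definition complete_metric (R : realType) (X : metricType R) : Prop :=
  forall u : nat -> X, cauchy (u @ \oo) -> exists l : X, u @ \oo --> l.

(* Maps are indexed from 1 on paper and from 0 here: if [f] is such a sequence,
   then [f n] is f_{n+1}. *)
Definition time_varying_map (R : realType) (X : metricType R)
    (f : nat -> X -> X) : Prop :=
  forall n, continuous (f n).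

(* [iterates f n] is f_n \o ... \o f_1 in 1-based indexing. *)
Fixpoint iterates (X : Type) (f : nat -> X -> X) (n : nat) : X -> X :=
  if n is m.+1 then f m \o iterates f m else id.

(* The infimum is taken in the extended reals; it is +oo when [X] has at most
   one point, and a nonnegative real number otherwise. *)
Definition expanding_ratio (R : realType) (X : metricType R)
    (f : nat -> X -> X) : \bar R :=
  ereal_inf [set ereal_inf
    [set (mdist (f n p.1) (f n p.2) / mdist p.1 p.2)%:E
      | p in [set p : X * X | p.1 != p.2]] | n in [set: nat]].

Definition uniformly_expanding (R : realType) (X : metricType R)
    (f : nat -> X -> X) : Prop :=
  (1 < expanding_ratio f)%E.

Definition pseudo_orbit (R : realType) (X : metricType R)
    (f : nat -> X -> X) (delta : R) (x_ : nat -> X) : Prop :=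
  forall n, mdist (f n (x_ n)) (x_ n.+1) < delta.

Definition limit_pseudo_orbit (R : realType) (X : metricType R)
    (f : nat -> X -> X) (x_ : nat -> X) : Prop :=
  mdist (f n (x_ n)) (x_ n.+1) @[n --> \oo] --> (0 : R).

Definition exp_cvg0 (R : realType) (theta : R) (a : nat -> R) : Prop :=
  exists2 L : R, 0 < L & forall n, `|a n| <= L * theta ^+ n.

Definition exp_limit_pseudo_orbit (R : realType) (X : metricType R)
    (f : nat -> X -> X) (theta : R) (x_ : nat -> X) : Prop :=
  exp_cvg0 theta (fun n => mdist (f n (x_ n)) (x_ n.+1)).

Definition shadows (R : realType) (X : metricType R)
    (f : nat -> X -> X) (eps : R) (x_ : nat -> X) (x : X) : Prop :=
  forall n, mdist (iterates f n x) (x_ n) < eps.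

Definition limit_shadows (R : realType) (X : metricType R)
    (f : nat -> X -> X) (x_ : nat -> X) (x : X) : Prop :=
  mdist (iterates f n x) (x_ n) @[n --> \oo] --> (0 : R).

Definition exp_limit_shadows (R : realType) (X : metricType R)
    (f : nat -> X -> X) (theta : R) (x_ : nat -> X) (x : X) : Prop :=
  exp_cvg0 theta (fun n => mdist (iterates f n x) (x_ n)).

Definition shadowing_property (R : realType) (X : metricType R)
    (f : nat -> X -> X) : Prop :=
  forall eps : R, 0 < eps -> exists2 delta : R, 0 < delta &
    forall x_, pseudo_orbit f delta x_ -> exists x, shadows f eps x_ x.

Definition limit_shadowing_property (R : realType) (X : metricType R)
    (f : nat -> X -> X) : Prop :=
  forall x_, limit_pseudo_orbit f x_ -> exists x, limit_shadows f x_ x.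

Definition exp_limit_shadowing_property (R : realType) (X : metricType R)
    (f : nat -> X -> X) : Prop :=
  exists2 theta0 : R, 0 < theta0 < 1 &
    forall theta : R, theta0 < theta < 1 ->
    forall x_, exp_limit_pseudo_orbit f theta x_ ->
      exists x, exp_limit_shadows f theta x_ x.

(* In the second clause the same point shadows and limit shadows. *)
Definition s_limit_shadowing_property (R : realType) (X : metricType R)
    (f : nat -> X -> X) : Prop :=
  forall eps : R, 0 < eps -> exists2 delta : R, 0 < delta &
    forall x_, pseudo_orbit f delta x_ ->
      (exists x, shadows f eps x_ x) /\
      (limit_pseudo_orbit f x_ ->
        exists x, shadows f eps x_ x /\ limit_shadows f x_ x).

(* Main.v *)
(** Let [b > 1] be the expansion constant.  By surjectivity choose [y_n] with
    [F_n y_n = x_n], where [F_n] is the [n]-th iterate.  If the one-step errors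
    of the pseudo orbit are at most [A], then backward induction from [k = n]
    along [b d(u, v) <= d(f_k u, f_k v)] bounds [d(F_k y_n, x_k)] by
    [c = A / (b - 1)], the fixed point of [c = (c + A) / b].  For [k = m] this
    gives [d(y_m, y_n) <= c / b ^ m], so [y] is Cauchy, and its limit [z] stays
    within [c] of the pseudo orbit.

    The distances [e_k = d(F_k z, x_k)] are bounded and satisfy
    [b e_k <= e_(k+1) + a_k] with [a] the errors, and bounded sequences obey a
    comparison principle for this inequality: a supersolution of it dominates
    [e].  Constant supersolutions give limit shadowing and multiples of
    [theta ^ k] give exponential shadowing, always at the same point [z]. *)
Require Import Defs.
From mathcomp Require Import all_boot all_order all_algebra.
From mathcomp Require Import all_classical all_reals all_analysis.
From mathcomp Require Import lra.

Set Implicit Arguments.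
Unset Strict Implicit.
Unset Printing Implicit Defensive.

Import Order.TTheory GRing.Theory Num.Theory.
Import numFieldNormedType.Exports.

Local Open Scope classical_set_scope.
Local Open Scope ring_scope.

Lemma near_div_exp_lt (R : realType) (b M e : R) : 1 < b -> 0 < e ->
  \forall n \near \oo, M / b ^+ n < e.
Proof.
move=> b1 e0; have b0 : 0 < b by rewrite (lt_trans ltr01).
have /cvgr0Pnorm_lt/(_ _ e0) : geometric M b^-1 @ \oo --> 0.
  by apply: cvg_geometric; rewrite gtr0_norm ?invr_gt0// invf_lt1.
by apply: filterS => n; rewrite /= exprVn; apply: le_lt_trans; exact: ler_norm.
Qed.

(** A positive value would grow by a factor of at least [b] at each step and eventually exceed
    [M]. *)
Lemma bounded_expanding_le0 (R : realType) (b M : R) (g : nat -> R) :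
  1 < b -> (forall k, g k <= M) -> (forall k, b * g k <= g k.+1) ->
  forall k, g k <= 0.
Proof.
move=> b1 gM gS k; rewrite leNgt; apply/negP => gk0.
have b0 : 0 < b by rewrite (lt_trans ltr01).
have gk j : b ^+ j * g k <= g (k + j)%N.
  elim: j => [|j IH]; first by rewrite expr0 mul1r addn0.
  by rewrite exprS -mulrA addnS (le_trans _ (gS _))// ler_pM2l.
have [N _ /(_ _ (leqnn N))] := near_div_exp_lt M b1 gk0.
by rewrite /= ltNge ler_pdivlMr ?exprn_gt0// mulrC (le_trans (gk N)).
Qed.

(** Subtracting the two inequalities cancels [a], so [e - c] expands by [b]; it is bounded by [M]
    because [c] is nonnegative. *)
Lemma comparison_principle (R : realType) (b M : R) (a c e : nat -> R) :
  1 < b -> (forall k, e k <= M) -> (forall k, 0 <= c k) ->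
  (forall k, b * e k <= e k.+1 + a k) ->
  (forall k, c k.+1 + a k <= b * c k) -> forall k, e k <= c k.
Proof.
move=> b1 eM c0 eS cS k; rewrite -subr_le0.
apply: (@bounded_expanding_le0 _ b M (fun k => e k - c k)) => // j.
  by rewrite lerBlDr (le_trans (eM j))// lerDl.
rewrite mulrBr.
have := eS j; have := cS j; lra.
Qed.

Section Expanding.
Context (R : realType) (X : metricType R) (f : nat -> X -> X).

Lemma uniformly_expandingP : uniformly_expanding f ->
  exists2 b : R, 1 < b &
    forall n x y, b * mdist x y <= mdist (f n x) (f n y).
Proof.
move=> f_exp.
have [b b1 bf] : exists2 b : R, 1 < b & (b%:E <= expanding_ratio f)%E.
  move: f_exp; rewrite /uniformly_expanding.
  case: (expanding_ratio f) => [r|_|//]; first by exists r.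
  (* The ratio is [+oo] when [X] has at most one point; any constant above 1 then serves. *)
  by exists 2; rewrite ?leey// ltr1n.
exists b => // n x y; have [->|xy] := eqVneq x y; first by rewrite !mdistxx mulr0.
rewrite -ler_pdivlMr ?mdist_gt0// -lee_fin.
apply: (le_trans bf).
apply: (@le_trans _ _ (ereal_inf [set (mdist (f n p.1) (f n p.2) /
  mdist p.1 p.2)%:E | p in [set p : X * X | p.1 != p.2]])).
  by apply: ereal_inf_lbound; exists n.
by apply: ereal_inf_lbound; exists (x, y).
Qed.

Lemma iterates_surj : (forall n, set_surj [set: X] [set: X] (f n)) ->
  forall n y, exists x, iterates f n x = y.
Proof.
move=> f_surj; elim=> [|n IH] y; first by exists y.
have [z _ <-] := f_surj n y I; have [x <-] := IH z.
by exists x.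
Qed.

Lemma iterates_continuous : (forall n, continuous (f n)) ->
  forall n, continuous (iterates f n).
Proof.
move=> f_cont; elim=> [|n IH] x; first exact: cvg_id.
by apply: continuous_comp; [exact: IH|exact: f_cont].
Qed.

Context (b : R).
Hypothesis b_gt1 : 1 < b.
Hypothesis f_exp : forall n x y, b * mdist x y <= mdist (f n x) (f n y).

Let b_gt0 : 0 < b. Proof. exact: lt_trans ltr01 b_gt1. Qed.

Lemma iterates_expanding n x y :
  b ^+ n * mdist x y <= mdist (iterates f n x) (iterates f n y).
Proof.
elim: n => [|n IH]; first by rewrite expr0 mul1r.
by rewrite exprS -mulrA (le_trans _ (f_exp _ _ _))// ler_pM2l.
Qed.

Lemma shadowing_distS (x_ : nat -> X) z k :
  b * mdist (iterates f k z) (x_ k) <=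
  mdist (iterates f k.+1 z) (x_ k.+1) + mdist (f k (x_ k)) (x_ k.+1).
Proof.
apply: (le_trans (f_exp _ _ _)).
by rewrite [X in _ + X]metric_sym; exact: metric_triangle.
Qed.

Lemma pullback_dist (x_ : nat -> X) (A : R) y n k :
  (forall n, mdist (f n (x_ n)) (x_ n.+1) <= A) ->
  iterates f n y = x_ n -> (k <= n)%N ->
  mdist (iterates f k y) (x_ k) <= A / (b - 1).
Proof.
move=> xA yn; have b10 : 0 < b - 1 by rewrite subr_gt0.
have A0 : 0 <= A by rewrite (le_trans _ (xA 0%N))// mdist_ge0.
(* Induction on the gap [j] between [k'] and [n] runs backward from [k' = n], where the distance is
   0. *)
suff H j k' : (k' + j)%N = n -> mdist (iterates f k' y) (x_ k') <= A / (b - 1).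
  by move=> /subnKC; exact: H.
elim: j k' => [|j IH] k'.
  by rewrite addn0 => ->; rewrite yn mdistxx divr_ge0// ltW.
rewrite addnS -addSn => /IH kS; rewrite -(ler_pM2l b_gt0).
apply: (le_trans (shadowing_distS x_ y k')).
apply: (le_trans (lerD kS (xA k'))).
(* Writing [A] as [A / (b - 1) * (b - 1)] makes the fixed-point equation linear. *)
by rewrite -[X in _ + X](divfK (lt0r_neq0 b10)) mulrC; lra.
Qed.

Lemma pullback_cauchy (x_ y_ : nat -> X) (A : R) :
  (forall n, mdist (f n (x_ n)) (x_ n.+1) <= A) ->
  (forall n, iterates f n (y_ n) = x_ n) -> cauchy (y_ @ \oo).
Proof.
move=> xA yx; apply: cauchy_exP => e e0.
have [m _ /(_ _ (leqnn m)) Ame] := near_div_exp_lt (A / (b - 1)) b_gt1 e0.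
exists (y_ m), m => // n /= mn; rewrite ballEmdist /=.
apply: le_lt_trans Ame; rewrite ler_pdivlMr ?exprn_gt0// mulrC.
rewrite (le_trans (iterates_expanding m _ _))// yx metric_sym.
exact: (pullback_dist xA (yx n) mn).
Qed.

Hypothesis X_complete : complete_metric X.
Hypothesis f_cont : time_varying_map f.
Hypothesis f_surj : forall n, set_surj [set: X] [set: X] (f n).

Lemma bounded_shadowing (x_ : nat -> X) (A : R) :
  (forall n, mdist (f n (x_ n)) (x_ n.+1) <= A) ->
  exists z, forall n, mdist (iterates f n z) (x_ n) <= A / (b - 1).
Proof.
move=> xA; have [y_ yx] := choice (fun n => iterates_surj f_surj n (x_ n)).
have [z yz] := X_complete (pullback_cauchy xA yx).
exists z => k; apply/ler_addgt0Pl => e e0.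
have Fyz : iterates f k (y_ n) @[n --> \oo] --> iterates f k z.
  by apply: continuous_cvg yz; exact: iterates_continuous.
have [N _ zN] := metricType_numDomainType.cvgr_dist_le Fyz e0.
(* An index beyond both [N] and [k] is close to the limit and also in the range of
   [pullback_dist]. *)
have := zN _ (leq_maxl N k); have := pullback_dist xA (yx _) (leq_maxr N k).
move=> yk zy; exact: le_trans (metric_triangle _ _ _) (lerD zy yk).
Qed.

Lemma bounded_limit_shadows (x_ : nat -> X) (M : R) z :
  (forall n, mdist (iterates f n z) (x_ n) <= M) ->
  limit_pseudo_orbit f x_ -> limit_shadows f x_ z.
Proof.
move=> zM xl; apply/cvgr0Pnorm_le => e e0.
have b10 : 0 < b - 1 by rewrite subr_gt0.
(* Once errors are at most [e * (b - 1)], the constant [e] is a supersolution, as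
   [e + e * (b - 1) = b * e]; the orbit is shifted by [N] to start there. *)
have /cvgr0Pnorm_le/(_ _ (mulr_gt0 e0 b10)) [N _ xN] := xl.
exists N => // n /= Nn; rewrite ger0_norm ?mdist_ge0// -(subnK Nn).
apply: (@comparison_principle _ b M
  (fun k => mdist (f (k + N)%N (x_ (k + N)%N)) (x_ (k + N).+1)) (cst e)
  (fun k => mdist (iterates f (k + N) z) (x_ (k + N)%N))) => // [k|k|k].
- exact: ltW.
- exact: shadowing_distS.
- have := xN _ (leq_addl k N); rewrite /= ger0_norm ?mdist_ge0//; lra.
Qed.

Lemma bounded_exp_limit_shadows (x_ : nat -> X) (M theta : R) z :
  0 < theta < 1 ->
  (forall n, mdist (iterates f n z) (x_ n) <= M) ->
  exp_limit_pseudo_orbit f theta x_ -> exp_limit_shadows f theta x_ z.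
Proof.
move=> /andP[t0 t1] zM [L L0 xL].
have bt0 : 0 < b - theta by rewrite subr_gt0 (lt_trans t1).
(* This constant [C] solves [C * theta + L = b * C], so [C * theta ^+ k] is a supersolution for
   errors [L * theta ^+ k]. *)
exists (L / (b - theta)) => [|n]; first exact: divr_gt0.
rewrite ger0_norm ?mdist_ge0//.
apply: (comparison_principle b_gt1 zM _ (shadowing_distS x_ z)
  (c := fun n => L / (b - theta) * theta ^+ n)) => k.
  by rewrite mulr_ge0 ?exprn_ge0 ?divr_ge0// ltW.
have := xL k; rewrite ger0_norm ?mdist_ge0// exprS.
rewrite -{1}(divfK (lt0r_neq0 bt0) L); lra.
Qed.

Lemma limit_pseudo_orbit_bounded (x_ : nat -> X) : limit_pseudo_orbit f x_ ->
  exists A, forall n, mdist (f n (x_ n)) (x_ n.+1) <= A.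
Proof.
move=> /cvgP/cvg_seq_bounded xb; have [A xA] := @filter_ex _ (+oo : set_system R) _ _ xb.
by exists A => n; apply: le_trans (xA n I); exact: ler_norm.
Qed.

End Expanding.

Theorem theorem5p7 (R : realType) (X : metricType R) (f : nat -> X -> X)
    (X_complete : complete_metric X)
    (f_cont : time_varying_map f)
    (f_expanding : uniformly_expanding f)
    (f_surj : forall n, set_surj [set: X]%classic [set: X]%classic (f n)) :
  [/\ shadowing_property f,
      limit_shadowing_property f,
      exp_limit_shadowing_property f &
      s_limit_shadowing_property f].
Proof.
have [b b1 f_exp] := uniformly_expandingP f_expanding.
have shadow := bounded_shadowing b1 f_exp X_complete f_cont f_surj.
have b10 : 0 < b - 1 by rewrite subr_gt0.
have s_limit : s_limit_shadowing_property f.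
  (* This [delta] gives the bound [e / 2], and halving keeps the final inequality strict. *)
  move=> e e0; exists (e / 2 * (b - 1)) => [|x_ xd].
    by rewrite mulr_gt0 ?divr_gt0.
  have [z] := shadow _ _ (fun n => ltW (xd n)).
  rewrite mulfK ?lt0r_neq0// => ze.
  have zs : shadows f e x_ z by move=> n; have := ze n; lra.
  split=> [|xl]; first by exists z.
  by exists z; split=> //; exact: (bounded_limit_shadows b1 f_exp ze).
split=> //.
- move=> e /s_limit[d d0 xd]; exists d => // x_ /xd[] //.
- move=> x_ xl; have [A xA] := limit_pseudo_orbit_bounded xl.
  have [z zA] := shadow _ _ xA.
  by exists z; exact: (bounded_limit_shadows b1 f_exp zA).
(* Any threshold in (0, 1) works, since [theta < 1 < b]. *)
- exists (1 / 2) => [|theta /andP[t0 t1] x_ xe]; first by apply/andP; split; lra.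
  have t01 : 0 < theta < 1 by apply/andP; split=> //; lra.
  have [L L0 xL] := xe.
  (* Powers of [theta] are at most 1, so [L] bounds all errors. *)
  have [|z zL] := shadow x_ L.
    move=> n; apply: le_trans (ler_norm _) (le_trans (xL n) _).
    case/andP: t01 => t00 _; apply: ler_piMr; first exact: ltW.
    by apply: exprn_ile1; exact: ltW.
  by exists z; exact: (bounded_exp_limit_shadows b1 f_exp t01 zL).
Qed.
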